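(* Let $I,J\subseteq[n]$ satisfy $|I|=|J|$ and let $\lambda\vdash n$. If $\lambda$ has more than $2$ parts, then $\chi^\lambda\{I,J\}=0$. If $\lambda=(n-i,i)$ has at most $2$ parts, then $$\chi^\lambda\{I,J\}=\sum_{t=\max(0,\,i-|I-J|)}^{|I\cap J|}(-1)^{t+i}\cdot\binom{|I\cap J|}{t}\cdot(n-|I\cup J|)_t\cdot b_t!\cdot(n-2b_t)!\cdot\binom{n-b_t-i}{n-2b_t},$$ where $b_t:=|I-J|+t$.
   Context: $[n]=\{1,\dots,n\}$, $\mathfrak{S}_n$ is the symmetric group on $[n]$, and $\chi^\lambda$ is the irreducible complex character of $\mathfrak{S}_n$ indexed by the partition $\lambda\vdash n$ (so that its Frobenius characteristic is the Schur function $s_\lambda$), extended linearly to the group algebra $\mathbb{C}[\mathfrak{S}_n]$. For $I,J\subseteq[n]$ with $|I|=|J|$, $$\{I,J\}:=\sum_{w\in\mathfrak{S}_n,\ w(I)=J}w\in\mathbb{C}[\mathfrak{S}_n],$$ and $\chi^\lambda\{I,J\}:=\chi^\lambda(\{I,J\})$. $I-J$ denotes set difference. $(m)_t:=m(m-1)\cdots(m-t+1)$ is the falling factorial, with $(m)_0=1$. For $i=0$, $(n-i,i)$ means the one-part partition $(n)$.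
   Formalization: The formula for λ=(n-i,i) is false as printed when |I-J|≥2 (n=4, λ=(4), I={1,2}, J={3,4}: the left side is 4, the right side 2); the formal theorem multiplies the sum by |I-J|!, which changes nothing for |I-J|≤1. *)

(* Defs.v *)
From HB Require Import structures.
From mathcomp Require Import all_boot all_order all_algebra all_fingroup all_field all_character.
From mathcomp Require Export mpoly.

Set Implicit Arguments.
Unset Strict Implicit.
Unset Printing Implicit Defensive.

Import GRing.Theory.
Local Open Scope ring_scope.

Definition is_partition (n : nat) (lam : seq nat) : bool :=
  [&& sorted geq lam, 0%N \notin lam & sumn lam == n].

(* The partition (n - i, i), with zero parts dropped: (n) for i = 0, and the
   empty partition for n = i = 0. *)
Definition two_row (n i : nat) : seq nat :=
  if i == 0%N then nseq (0 < n) n else [:: (n - i)%N; i].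

(* Boxes of the Young diagram (English convention): tag = row,
   tagged = column. *)
Definition box (lam : seq nat) : finType :=
  {r : 'I_(size lam) & 'I_(nth 0%N lam r)}.

Definition box_row (lam : seq nat) (a : box lam) : nat := tag a.
Definition box_col (lam : seq nat) (a : box lam) : nat := tagged a.

(* Semistandard: weakly increasing along rows, strictly down columns. *)
Definition semistandard (N : nat) (lam : seq nat)
    (T : {ffun box lam -> 'I_N}) : bool :=
  [forall a : box lam, forall b : box lam,
     ((box_row a == box_row b) && (box_col a < box_col b)%N ==> (T a <= T b)%N)
  && ((box_col a == box_col b) && (box_row a < box_row b)%N ==> (T a < T b)%N)].

Definition schur (N : nat) (lam : seq nat) : {mpoly algC[N]} :=
  \sum_(T : {ffun box lam -> 'I_N} | semistandard T) \prod_a 'X_(T a).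

Definition power_sum (N k : nat) : {mpoly algC[N]} := \sum_(j < N) 'X_j ^+ k.

(* (1/n!) \sum_w chi(w) p_(cycle type of w), evaluated in N variables;
   porbits w is the set of cycles of w, fixed points included. *)
Definition frobenius_ch (N n : nat) (chi : 'CF([set: 'S_n])) : {mpoly algC[N]} :=
  (n`!%:R)^-1 *:
    \sum_(w : 'S_n) chi w *: \prod_(C in porbits w) power_sum N #|C|.

(* chi is the irreducible character chi^lam.  Equality in the ring of symmetric
   functions is equality in every finite number N of variables. *)
Definition is_irr_char_of (n : nat) (lam : seq nat)
    (chi : 'CF([set: 'S_n])) : Prop :=
  chi \in irr [set: 'S_n] /\ forall N : nat, frobenius_ch N chi = schur N lam.

(* The element {I, J} of the group algebra C[S_n], in the matrix model of
   mxrepresentation: gset_mx is the sum of the elements of a set. *)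
Definition bracket (n : nat) (I J : {set 'I_n}) : 'M[algC]_#|[set: 'S_n]| :=
  gset_mx algC [set: 'S_n]%G [set w : 'S_n | w @: I == J].

(* Main.v *)
Require Import Defs.
From HB Require Import structures.
From mathcomp Require Import all_boot all_order all_algebra all_fingroup all_field all_character.
From mathcomp Require Import ring zify.

(** For any class function f, the sum of f over the permutations w with
    w(I) = J reduces to sums over the w with w(D) = E for _disjoint_ D and E.
    Put A = I :&: J, D = I :\: J, E = J :\: I and let Q be the complement of
    I :|: J.  Because f(w) = f(h w h^-1), the condition w(I) = J may be
    traded for the weaker-looking pair w(D) = E, w(A) \subset I
    ([sum_transporter]): the w of the first kind with w^-1(A) = B are conjugate
    to those of the second kind with w(A) = B by an involution exchanging A
    and B inside I.  Given w(D) = E, the second condition says that w(A) does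
    not meet Q, so inclusion-exclusion over the subsets S of A sent into Q
    yields an alternating sum over t = #|S|, whose terms are sums over the w
    with w(D) = E and w(S) = U, that is, up to a binomial coefficient, over
    the w carrying D :|: S to the disjoint set E :|: U.  This is
    [sum_transporter_disjoint]; it explains the shape of the formula, with
    b = #|D| + t.

    It remains to know f = chi^lam on disjoint transporters.  Let P_w be the
    polynomial whose k-th coefficient counts the w-invariant k-subsets; that
    coefficient is the value at w of the permutation character pi_k on
    k-subsets.  P_w is also the product of the 1 + 'X^#|C| over the cycles C
    of w, i.e. a product of power sums in the variables 1, 'X, so the
    Frobenius characteristic hypothesis, in two variables, computes the inner
    products of chi with all pi_k.  If lam has more than two rows they all
    vanish, since there is no semistandard tableau with two values; then the
    operator sum over the stabilizer of I is, up to a scalar, an idempotent of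
    trace 0, hence 0, and so is its translate over the transporter of I to J.
    If lam = (n - i, i) the inner product with pi_k is 0 for k < i and 1 for
    k = i.  The function theta = pi_i - pi_(i-1), which is the i-th
    coefficient of (1 - 'X) P_w, has the same inner products with the pi_k for
    k <= i ([sum_two_row_char_mul]).  So theta has inner product 1 with itself
    and with chi, which has norm 1 by irreducibility: chi = theta
    ([irr_two_row]).

    Finally, for disjoint D and E of size b, counting pairs (w, S) with
    w(D) = E and w(S) = S gives b! times the polynomial
    [pair_poly] b (n - 2 b), and a recursion in b gives the coefficients of
    its product by 1 - 'X ([coef_pair_poly]). *)

Import GRing.Theory Num.Theory.
Local Open Scope ring_scope.
Set Implicit Arguments.
Unset Strict Implicit.
Unset Printing Implicit Defensive.

(** * Images of sets under permutations *)

Lemma imset_permM (T : finType) (s t : {perm T}) (A : {set T}) :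
  (s * t)%g @: A = t @: (s @: A).
Proof. by rewrite -imset_comp; apply: eq_imset => x /=; rewrite permM. Qed.

Lemma imset_permK (T : finType) (s : {perm T}) (A : {set T}) :
  s^-1%g @: (s @: A) = A.
Proof.
rewrite -imset_permM mulgV -[RHS]imset_id; apply: eq_imset => x.
by rewrite perm1.
Qed.

Lemma imset_permKV (T : finType) (s : {perm T}) (A : {set T}) :
  s @: (s^-1%g @: A) = A.
Proof. by rewrite -{1}(invgK s) imset_permK. Qed.

Lemma imset_permV_eq (T : finType) (s : {perm T}) (A B : {set T}) :
  (s^-1%g @: A == B) = (s @: B == A).
Proof.
apply/eqP/eqP => [<-|<-]; first exact: imset_permKV.
exact: imset_permK.
Qed.

Lemma mem_imset_perm (T : finType) (s : {perm T}) (A : {set T}) x :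
  (s x \in s @: A) = (x \in A).
Proof. exact/mem_imset/perm_inj. Qed.

Lemma imset_permD (T : finType) (s : {perm T}) (A B : {set T}) :
  s @: (A :\: B) = s @: A :\: s @: B.
Proof.
by apply/setP=> y; rewrite -(permKV s y) inE !mem_imset_perm inE.
Qed.

Lemma imset_permI (T : finType) (s : {perm T}) (A B : {set T}) :
  s @: (A :&: B) = s @: A :&: s @: B.
Proof.
by apply/setP=> y; rewrite -(permKV s y) inE !mem_imset_perm inE.
Qed.

Lemma imset_perm_subset (T : finType) (s : {perm T}) (A B : {set T}) :
  (s @: A \subset s @: B) = (A \subset B).
Proof. by rewrite -!setD_eq0 -imset_permD imset_eq0. Qed.

Lemma imset_perm_inj (T : finType) (s : {perm T}) :
  injective (fun A : {set T} => s @: A).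
Proof. exact/imset_inj/perm_inj. Qed.

Lemma card_imset_perm (T : finType) (s : {perm T}) (A : {set T}) :
  #|s @: A| = #|A|.
Proof. exact/card_imset/perm_inj. Qed.

Lemma imset_perm_fixed (T : finType) (s : {perm T}) (A : {set T}) :
  {in A, forall x, s x = x} -> s @: A = A.
Proof. by move=> sA; rewrite (eq_in_imset sA) imset_id. Qed.

(** Exchanging one element of A :\: B with one of B :\: A by a transposition
    brings A closer to B, and the remaining permutation fixes both elements,
    so that the two factors commute and the product still exchanges A and B. *)
Lemma exists_swap (T : finType) (A B : {set T}) : #|A| = #|B| ->
  exists h : {perm T}, [/\ h @: A = B, h @: B = A
    & forall x, (x \in A) = (x \in B) -> h x = x].
Proof.
have [m] := ubnP #|A :\: B|; elim: m A => // m IH A; rewrite ltnS => leAm eqAB.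
have [AB0|[a]] := set_0Vmem (A :\: B).
  have/eqP sAB: A == B.
    by rewrite eqEcard eqAB leqnn andbT -setD_eq0 AB0.
  exists 1%g; rewrite sAB; split=> [||x _]; rewrite ?perm1 //.
    by apply: imset_perm_fixed => x _; rewrite perm1.
  by apply: imset_perm_fixed => x _; rewrite perm1.
rewrite inE => /andP[aB aA].
have [BA0|[b]] := set_0Vmem (B :\: A).
  have/eqP sAB: B == A.
    by rewrite eqEcard eqAB leqnn andbT -setD_eq0 BA0.
  by rewrite sAB aA in aB.
rewrite inE => /andP[bA bB].
have neq_ab: a != b by apply: contraNneq aB => ->.
pose A1 := b |: (A :\ a).
have tA : tperm a b @: A = A1.
  apply/setP=> y; rewrite -(permKV (tperm a b) y) mem_imset_perm tpermV.
  rewrite !inE tpermK; case: tpermP => [->|->|/eqP ya /eqP yb].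
  - by rewrite (negPf bA) eqxx (negPf neq_ab).
  - by rewrite aA eqxx.
  - by rewrite ya (negPf yb).
have tA1 : tperm a b @: A1 = A.
  by rewrite -tA -{1}(tpermV a b) imset_permK.
have cA1 : #|A1| = #|B| by rewrite -tA card_imset_perm.
have lt1 : (#|A1 :\: B| < m)%N.
  apply: leq_trans leAm; apply: proper_card; apply/properP; split.
    apply/subsetP=> x; rewrite !inE => /andP[xB /orP[/eqP xb|/andP[_ ->]]].
      by rewrite xb bB in xB.
    by rewrite xB.
  exists a; first by rewrite !inE aB.
  by rewrite !inE eqxx (negPf neq_ab) andbF.
have [h [hA hB hfix]] := IH A1 lt1 cA1.
have ha : h a = a by apply: hfix; rewrite !inE eqxx (negPf aB) (negPf neq_ab).
have hb : h b = b by apply: hfix; rewrite !inE eqxx bB.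
have comm : (tperm a b * h = h * tperm a b)%g.
  by rewrite -{2}ha -{2}hb -tpermJ conjgC.
exists (tperm a b * h)%g; split.
- by rewrite imset_permM tA.
- by rewrite comm imset_permM hB.
move=> x xAB; rewrite permM tpermD.
- apply: hfix; rewrite !inE xAB.
  have [->|_] := eqVneq x a; first by rewrite (negPf aB) (negPf neq_ab).
  by have [->|_] := eqVneq x b; first by rewrite bB.
- by apply: contraNneq aB => ax; rewrite ax -xAB -ax.
- by apply: contraNneq bA => bx; rewrite bx xAB -bx.
Qed.

Lemma exists_swap_stable (T : finType) (A B : {set T}) : #|A| = #|B| ->
  exists h : {perm T}, [/\ h @: A = B, h @: B = A,
    forall X : {set T}, A \subset X -> B \subset X -> h @: X = X
    & forall X : {set T}, [disjoint A & X] -> [disjoint B & X] -> h @: X = X].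
Proof.
move=> /exists_swap[h [hA hB hfix]].
have hdisj (X : {set T}) : [disjoint A & X] -> [disjoint B & X] -> h @: X = X.
  move=> dAX dBX; apply: imset_perm_fixed => x xX; apply: hfix.
  by rewrite (disjointFl dAX xX) (disjointFl dBX xX).
exists h; split=> // X sAX sBX.
have hC : h @: (~: X) = ~: X.
  by apply: hdisj; rewrite disjoints_subset setCK.
apply/setP=> y; rewrite -(permKV h y) mem_imset_perm; apply: negb_inj.
by rewrite -!in_setC -{2}hC mem_imset_perm.
Qed.

(** * Transporter sums of class functions *)
Section ClassFunction.

Variables (R : nmodType) (T : finType) (f : {perm T} -> R).
Hypothesis f_class : forall w h : {perm T}, f (w ^ h)%g = f w.

Lemma sum_conj (h : {perm T}) (S1 U1 S2 U2 : {set T}) :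
  \sum_(w : {perm T} | (w @: S1 == U1) && (w @: S2 == U2)) f w =
  \sum_(w : {perm T} | (w @: (h @: S1) == h @: U1) &&
                       (w @: (h @: S2) == h @: U2)) f w.
Proof.
rewrite [RHS](reindex_inj (@conjg_inj _ h)) /=; apply: eq_big => [w|w _].
  rewrite conjgE.
  have E (S U : {set T}) :
      ((h^-1 * (w * h))%g @: (h @: S) == h @: U) = (w @: S == U).
    by rewrite !imset_permM imset_permK (inj_eq (@imset_perm_inj _ h)).
  by rewrite !E.
by rewrite f_class.
Qed.

(** Sort the left sum by B = w^-1(A) and the right sum by B = w(A), where
    A = I :&: J.  For each B, conjugation by an involution exchanging A and B
    inside I turns the conditions w(I :\: B) = J :\: I, w(B) = A into
    w(I :\: A) = J :\: I, w(A) = B. *)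
Lemma sum_transporter (I J : {set T}) : #|I| = #|J| ->
  \sum_(w : {perm T} | w @: I == J) f w =
  \sum_(w : {perm T} | (w @: (I :\: J) == J :\: I) &&
                       (w @: (I :&: J) \subset I)) f w.
Proof.
move=> eqIJ; set D := I :\: J; set E := J :\: I; set A := I :&: J.
have AE : A :|: E = J by rewrite /A /E setIC setID.
rewrite (partition_big (fun w : {perm T} => w^-1%g @: A) predT) //=.
rewrite [RHS](partition_big (fun w : {perm T} => w @: A) predT) //=.
apply: eq_bigr => B _.
have [/andP[sBI /eqP cB]|nB] := boolP ((B \subset I) && (#|B| == #|A|)); last first.
  rewrite !big_pred0 // => w; apply/negP.
    case/andP=> /andP[_ sAI] /eqP wA; case/negP: nB.
    by rewrite -wA sAI card_imset_perm /=.
  rewrite imset_permV_eq => /andP[/eqP wI /eqP wB]; case/negP: nB.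
  rewrite -(imset_perm_subset w) wB wI subsetIr.
  by rewrite -wB card_imset_perm eqxx.
have [h [hA hB hsub hdisj]] := exists_swap_stable (esym cB).
have sAI : A \subset I by apply: subsetIl.
have hI : h @: I = I by apply: hsub.
have hE : h @: E = E.
  have dIE : [disjoint I & E].
    by rewrite -setI_eq0; apply/eqP/setP=> x; rewrite !inE; case: (x \in I).
  by apply: hdisj; [apply: disjointWl sAI dIE | apply: disjointWl sBI dIE].
have hD : h @: D = I :\: B
  by rewrite -hA -[in RHS]hI -imset_permD /A setDIr setDv set0U.
transitivity (\sum_(w : {perm T} | (w @: (I :\: B) == E) && (w @: B == A)) f w).
  apply: eq_bigl => w; rewrite imset_permV_eq.
  apply/andP/andP=> [] [/eqP w1 /eqP w2]; split; apply/eqP=> //.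
    by rewrite imset_permD w1 w2 /E /A setDIr setDv setU0.
  by rewrite -(setID I B) (setIidPr sBI) imsetU w1 w2.
have := sum_conj h D E A B; rewrite hD hE hA hB => <-; apply: eq_bigl => w.
by have [->|] := eqVneq (w @: A) B; rewrite ?andbF // sBI !andbT.
Qed.

End ClassFunction.

Lemma sum_subset_split (R : nmodType) (T : finType) (Z D : {set T})
    (F : {set T} -> {set T} -> R) : D \subset Z ->
  \sum_(S : {set T} | S \subset Z) F (S :&: D) (S :\: D) =
  \sum_(S1 : {set T} | S1 \subset D)
    \sum_(S2 : {set T} | S2 \subset Z :\: D) F S1 S2.
Proof.
move=> sDZ; rewrite pair_big /=.
rewrite (reindex_onto (fun S : {set T} => (S :&: D, S :\: D))
                      (fun p => p.1 :|: p.2)) /=; last first.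
  case=> S1 S2 /= /andP[sS1 sS2]; congr (_, _); apply/setP=> x;
  have := subsetP sS1 x; have := subsetP sS2 x; rewrite !inE;
  case: (x \in S1); case: (x \in S2); case: (x \in D) => //= H1 H2;
  solve [by have := H1 isT | by have := H2 isT].
apply: eq_bigl => S; rewrite setID eqxx andbT subsetIr /=.
apply/idP/idP => [sSZ|sS]; first exact: setSD.
by rewrite -(setID S D) subUset (subset_trans (subsetIr _ _) sDZ)
  (subset_trans sS (subsetDl _ _)).
Qed.

Lemma sum_subset_card (R : nmodType) (T : finType) (D : {set T})
    (g : nat -> R) :
  \sum_(S : {set T} | S \subset D) g #|S| =
  \sum_(x < #|D|.+1) g x *+ 'C(#|D|, x).
Proof.
rewrite (partition_big (fun S : {set T} => inord #|S| : 'I_#|D|.+1) predT) //=.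
apply: eq_bigr => x _.
have E (S : {set T}) : S \subset D -> (inord #|S| == x) = (#|S| == x :> nat).
  by move=> /subset_leq_card leSD; rewrite -val_eqE /= inordK.
transitivity (\sum_(S : {set T} | (S \subset D) && (#|S| == x :> nat)) g x).
  apply: eq_big => [S|S /andP[sSD]].
    by have [sSD|//] := boolP (S \subset D); rewrite E.
  by rewrite E // => /eqP ->.
rewrite sumr_const -(cards_draws D x); congr (_ *+ _).
by apply: eq_card => S; rewrite inE.
Qed.

Lemma sum_signed_subsets (R : comNzRingType) (T : finType) (Z : {set T}) :
  \sum_(S : {set T} | S \subset Z) (-1) ^+ #|S| = (Z == set0)%:R :> R.
Proof.
rewrite (sum_subset_card Z (fun x => (-1) ^+ x)).
rewrite -cards_eq0 -(expr0n R) -[in RHS](subrr 1) exprDn.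
by apply: eq_bigr => x _; rewrite expr1n mul1r.
Qed.

(** Split the right sum by the set B = w(D): it ranges over the subsets of
    E :|: U of size #|D|, and every B contributes as much as B = E, by
    conjugation with an involution that exchanges B and E and is trivial on
    D :|: S. *)
Lemma sum_transporter_refine (R : nmodType) (T : finType) (f : {perm T} -> R)
    (f_class : forall w h : {perm T}, f (w ^ h)%g = f w) (D S E U : {set T}) :
  [disjoint D & S] -> [disjoint E & U] -> [disjoint D :|: S & E :|: U] ->
  #|D| = #|E| -> #|S| = #|U| ->
  (\sum_(w : {perm T} | (w @: D == E) && (w @: S == U)) f w)
      *+ 'C(#|D| + #|S|, #|D|) =
  \sum_(w : {perm T} | w @: (D :|: S) == E :|: U) f w.
Proof.
move=> dDS dEU dDE cDE cSU; set X := E :|: U.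
have cX : #|X| = (#|D| + #|S|)%N.
  by rewrite /X cardsU (disjoint_setI0 dEU) cards0 subn0 cDE cSU.
rewrite [RHS](partition_big (fun w : {perm T} => w @: D)
  (fun B => B \in [set B : {set T} | (B \subset X) & (#|B| == #|D|)])) /=; last first.
  move=> w /eqP wX; rewrite inE card_imset_perm eqxx andbT -wX.
  by rewrite imset_perm_subset subsetUl.
rewrite -cX -cards_draws -sumr_const; apply: eq_bigr => B.
rewrite inE => /andP[sBX /eqP cB].
have cBE : #|B| = #|E| by rewrite cB.
have [h [hB hE hsub hdisj]] := exists_swap_stable cBE.
have sEX : E \subset X by apply: subsetUl.
have hX : h @: X = X by apply: hsub.
have hfix (Y : {set T}) : Y \subset D :|: S -> h @: Y = Y.
  move=> sY; have dXY : [disjoint X & Y].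
    by rewrite disjoint_sym; apply: disjointWl sY dDE.
  by apply: hdisj; [apply: disjointWl sBX dXY|apply: disjointWl sEX dXY].
have hD : h @: D = D by apply: hfix; apply: subsetUl.
have hS : h @: S = S by apply: hfix; apply: subsetUr.
have XE : X :\: E = U.
  by rewrite /X setDUl setDv set0U; apply/setDidPl; rewrite disjoint_sym.
have hU : h @: (X :\: B) = U by rewrite imset_permD hX hB.
have := sum_conj f_class h D B S (X :\: B).
rewrite hD hB hS hU => <-; apply: eq_bigl => w.
apply/andP/andP=> [] [/eqP w1 /eqP w2]; split; apply/eqP=> //.
  by rewrite imsetU w1 w2 -{1}(setIidPr sBX) setID.
have SD : S :\: D = S by apply/setDidPl; rewrite disjoint_sym.
by rewrite -w1 -w2 -imset_permD setDUl setDv set0U SD.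
Qed.

(** After [sum_transporter], inclusion-exclusion removes the condition
    w(I :&: J) \subset I: the set Z w of elements of I :&: J sent outside
    I :|: J has to be empty, and [w(S) \subset Q] selects the subsets S of
    Z w. *)
Lemma sum_transporter_disjoint (R : numFieldType) (T : finType)
    (f : {perm T} -> R) (f_class : forall w h : {perm T}, f (w ^ h)%g = f w)
    (G : nat -> R) (I J : {set T}) :
  (forall D E : {set T}, [disjoint D & E] -> #|D| = #|E| ->
    \sum_(w : {perm T} | w @: D == E) f w = #|D|`!%:R * G #|D|) ->
  #|I| = #|J| ->
  \sum_(w : {perm T} | w @: I == J) f w =
  #|I :\: J|`!%:R * \sum_(t < #|I :&: J|.+1) (-1) ^+ t *
    ('C(#|I :&: J|, t) * #|~: (I :|: J)| ^_ t)%:R * G (#|I :\: J| + t)%N.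
Proof.
move=> fG eqIJ; rewrite sum_transporter //.
set D := I :\: J; set E := J :\: I; set A := I :&: J; set Q := ~: (I :|: J).
have cDE : #|D| = #|E|.
  have := cardsID J I; have := cardsID I J; rewrite -/D -/E setIC eqIJ => <-.
  by move/addnI.
have dDE : [disjoint D & E].
  rewrite -setI_eq0; apply/eqP/setP=> x; rewrite !inE.
  by case: (x \in I); case: (x \in J).
pose Z (w : {perm T}) := A :&: w^-1%g @: Q.
have ZE (w : {perm T}) : w @: D == E -> (w @: A \subset I) = (Z w == set0).
  move=> /eqP wD; rewrite /Z -(inj_eq (@imset_perm_inj _ w) _ set0) imset0.
  rewrite (imset_permI w A) imset_permKV setI_eq0 disjoints_subset setCK.
  have dAE : [disjoint w @: A & E].
    rewrite -setI_eq0 -wD -imset_permI; apply/eqP.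
    have -> : A :&: D = set0; last by rewrite imset0.
    by apply/setP=> x; rewrite !inE; case: (x \in J); rewrite ?andbF.
  apply/idP/idP => sA; first exact: subset_trans sA (subsetUl _ _).
  apply/subsetP=> y yA; have := subsetP sA y yA.
  have := disjointFr dAE yA; rewrite !inE.
  by case: (y \in I) => //= ->.
have ZS (w : {perm T}) (S : {set T}) :
    (S \subset Z w) = (S \subset A) && (w @: S \subset Q).
  by rewrite subsetI -(imset_perm_subset w S (w^-1%g @: Q)) imset_permKV.
transitivity (\sum_(w : {perm T} | w @: D == E)
    \sum_(S : {set T} | (S \subset A) && (w @: S \subset Q))
       (-1) ^+ #|S| * f w).
  rewrite big_mkcondr /=; apply: eq_bigr => w wD; rewrite ZE //.
  under eq_bigl do rewrite -ZS.
  by rewrite -mulr_suml sum_signed_subsets; case: eqP; rewrite ?mul1r ?mul0r.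
rewrite (exchange_big_dep (fun S : {set T} => S \subset A)) /=; last first.
  by move=> w S _ /andP[].
transitivity (\sum_(S : {set T} | S \subset A) (-1) ^+ #|S| *
    (#|D|`!%:R * (#|Q| ^_ #|S|)%:R * G (#|D| + #|S|)%N)); last first.
  rewrite (sum_subset_card A (fun x => (-1) ^+ x *
    (#|D|`!%:R * (#|Q| ^_ x)%:R * G (#|D| + x)%N))) mulr_sumr.
  apply: eq_bigr => t _; rewrite -mulr_natl natrM.
  by ring.
apply: eq_bigr => S sSA; rewrite -mulr_sumr; congr (_ * _).
rewrite (partition_big (fun w : {perm T} => w @: S)
  (fun U => U \in [set U : {set T} | (U \subset Q) & (#|U| == #|S|)])) /=; last first.
  by move=> w /and3P[_ _ sSQ]; rewrite inE sSQ card_imset_perm eqxx.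
rewrite (eq_bigr (fun _ => #|D|`!%:R * #|S|`!%:R * G (#|D| + #|S|)%N)).
  rewrite sumr_const cards_draws -bin_ffact natrM -mulr_natl.
  by ring.
move=> U; rewrite inE => /andP[sUQ /eqP cU].
have dDS : [disjoint D & S].
  rewrite disjoint_sym; apply: disjointWl sSA _.
  by rewrite -setI_eq0; apply/eqP/setP=> x; rewrite !inE; case: (x \in J); rewrite ?andbF.
have dEU : [disjoint E & U].
  rewrite disjoint_sym; apply: disjointWl sUQ _.
  by rewrite -setI_eq0; apply/eqP/setP=> x; rewrite !inE; case: (x \in J); rewrite ?orbT ?andbF.
have dX : [disjoint D :|: S & E :|: U].
  rewrite -setI_eq0 -subset0; apply: subset_trans (setISS (setUS _ sSA) (setUS _ sUQ)) _.
  by apply/subsetP=> x; rewrite !inE; case: (x \in J); case: (x \in I).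
have := sum_transporter_refine f_class dDS dEU dX cDE (esym cU).
have cDS : #|D :|: S| = (#|D| + #|S|)%N.
  by rewrite cardsU (disjoint_setI0 dDS) cards0 subn0.
rewrite fG //; last first.
  by rewrite cDS cardsU (disjoint_setI0 dEU) cards0 subn0 cU cDE.
have nz : 'C(#|D| + #|S|, #|D|)%:R != 0 :> R.
  by rewrite pnatr_eq0 -lt0n bin_gt0 leq_addr.
rewrite cDS -(bin_fact (leq_addr #|S| #|D|)) addKn -[LHS]mulr_natl.
rewrite !natrM -[RHS]mulrA => /(mulfI nz) <-.
apply: eq_bigl => w; rewrite sSA /=.
have [/eqP wS|] := boolP (w @: S == U); last by rewrite !andbF.
by rewrite wS sUQ !andbT.
Qed.

(** * Counting permutations with prescribed images of two sets *)

(** Among the w with w(I) = J, the possible images V of S are the sets that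
    meet J and its complement in the same numbers as U does; a permutation
    stabilizing J and moving U to V shows that they are all equally
    frequent. *)
Lemma card_transporter_refine (T : finType) (I J S U : {set T}) :
  #|S :&: I| = #|U :&: J| -> #|S :\: I| = #|U :\: J| ->
  (#|[set w : {perm T} | (w @: I == J) && (w @: S == U)]|
     * ('C(#|J|, #|U :&: J|) * 'C(#|~: J|, #|U :\: J|)))%N =
  #|[set w : {perm T} | w @: I == J]|.
Proof.
move=> cSI cSD.
pose K := [set U' : {set T} |
  (#|U' :&: J| == #|U :&: J|) && (#|U' :\: J| == #|U :\: J|)].
have cK : #|K| = ('C(#|J|, #|U :&: J|) * 'C(#|~: J|, #|U :\: J|))%N.
  rewrite -sum1_card.
  transitivity (\sum_(V : {set T} | V \subset setT)
    ((#|V :&: J| == #|U :&: J|) && (#|V :\: J| == #|U :\: J|) : nat))%N.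
    rewrite big_mkcond /=; apply: eq_big => [V|V _]; first by rewrite subsetT.
    by rewrite inE; case: (_ && _).
  rewrite (sum_subset_split (fun V1 V2 => ((#|V1| == #|U :&: J|) &&
    (#|V2| == #|U :\: J|) : nat)) (subsetT J)).
  have binE (D : {set T}) k :
      'C(#|D|, k) = (\sum_(V : {set T} | V \subset D) (#|V| == k))%N.
    rewrite -cards_draws -sum1_card.
    rewrite (eq_bigl (fun V : {set T} => (V \subset D) && (#|V| == k))).
      by rewrite big_mkcondr /=; apply: eq_bigr => V _; case: eqP.
    by move=> V; rewrite inE.
  rewrite !binE big_distrlr /=; apply: eq_bigr => V1 _.
  by rewrite setTD; apply: eq_bigr => V2 _; rewrite mulnb.
rewrite -cK -[RHS]sum1_card.
rewrite (partition_big (fun w : {perm T} => w @: S) (fun V => V \in K)) /=; last first.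
  move=> w; rewrite !inE => /eqP wI.
  by rewrite -wI -imset_permI -imset_permD !card_imset_perm cSI cSD wI !eqxx.
rewrite mulnC -sum_nat_const; apply: eq_bigr => V; rewrite inE => /andP[/eqP c1 /eqP c2].
have [h1 [h1A h1B h1sub h1dis]] := exists_swap_stable (esym c1).
have [h2 [h2A h2B h2sub h2dis]] := exists_swap_stable (esym c2).
have dJ (W : {set T}) : [disjoint W :\: J & J].
  by rewrite -setI_eq0; apply/eqP/setP=> x; rewrite !inE; case: (x \in J); rewrite ?andbF.
have dI (W W' : {set T}) : [disjoint W :&: J & W' :\: J].
  by rewrite -setI_eq0; apply/eqP/setP=> x; rewrite !inE; case: (x \in J); rewrite ?andbF.
pose h := (h1 * h2)%g.
have hJ : h @: J = J by rewrite imset_permM h1sub ?subsetIr // h2dis.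
have hU : h @: U = V.
  rewrite -(setID U J) imset_permM imsetU h1A h1dis // imsetU h2A.
  by rewrite h2dis ?setID // disjoint_sym.
rewrite -sum1_card [RHS](reindex_inj (@mulIg _ h)) /=; apply: eq_bigl => w.
rewrite !inE !imset_permM -!(imset_permM h1 h2) -/h -{2}hJ -hU.
by rewrite !(inj_eq (@imset_perm_inj _ h)).
Qed.

Lemma card_transporter (T : finType) (I J : {set T}) : #|I| = #|J| ->
  #|[set w : {perm T} | w @: I == J]| = (#|I|`! * #|~: I|`!)%N.
Proof.
move=> eqIJ; have := @card_transporter_refine T setT setT I J.
rewrite !setIT !setDT !cards0 !setCT !cards0 bin0 muln1 => /(_ eqIJ erefl).
have E (w : {perm T}) : w @: setT == setT :> {set T}.
  by rewrite eqEcard subsetT card_imset_perm leqnn.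
have -> : [set w : {perm T} | (w @: setT == setT) && (w @: I == J)] =
          [set w : {perm T} | w @: I == J].
  by apply/setP=> w; rewrite !inE E.
have -> : [set w : {perm T} | w @: setT == setT :> {set T}] = setT.
  by apply/setP=> w; rewrite !inE E.
have -> : #|[set: {perm T}]| = #|T|`!.
  rewrite -cardsT -card_perm; apply: eq_card => w; rewrite inE.
  by apply/esym/subsetP=> x; rewrite inE.
rewrite !cardsT -eqIJ => H; have leI : (#|I| <= #|T|)%N by apply: max_card.
have := bin_fact leI; rewrite -H -(cardsC I) addKn [in LHS]mulnC => /eqP.
rewrite eqn_pmul2r ?bin_gt0 ?leq_addr // => /eqP <- //.
Qed.

Lemma card_transporter_stable (T : finType) (I J S : {set T}) :
  #|I| = #|J| -> #|S :&: I| = #|S :&: J| ->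
  #|[set w : {perm T} | (w @: I == J) && (w @: S == S)]| =
  (#|S :&: I|`! * (#|I| - #|S :&: I|)`!
     * (#|S :\: I|`! * (#|~: I| - #|S :\: I|)`!))%N.
Proof.
move=> cIJ cS; have cSD : #|S :\: I| = #|S :\: J|.
  by have := cardsID I S; rewrite -(cardsID J S) cS => /addnI.
have cC : #|~: I| = #|~: J|.
  by have := cardsC I; rewrite -(cardsC J) cIJ => /addnI.
have le1 : (#|S :&: I| <= #|I|)%N by apply/subset_leq_card/subsetIr.
have le2 : (#|S :\: I| <= #|~: I|)%N.
  by apply/subset_leq_card; rewrite setDE subsetIr.
have := card_transporter_refine cS cSD; rewrite card_transporter //.
rewrite -cS -cSD -cC -cIJ -(bin_fact le1) -(bin_fact le2) => H.
apply/eqP; rewrite -(@eqn_pmul2r ('C(#|I|, #|S :&: I|) * 'C(#|~: I|, #|S :\: I|))).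
  by rewrite H; apply/eqP; rewrite mulnACA mulnC.
by rewrite muln_gt0 !bin_gt0 le1.
Qed.

(** * The generating polynomial of disjoint transporters *)

(** Up to the factor (m + 1)!, this is the linear form integrating over
    0 <= u <= 1 the homogenization of p in degree m at ('X, 1) = (u, 1 - u):
    the Beta integral of u^k (1 - u)^(m - k) is k! (m - k)! / (m + 1)!. *)
Definition beta_form (A : comNzRingType) (m : nat) (p : {poly A}) : A :=
  \sum_(k < m.+1) p`_k * (k`! * (m - k)`!)%:R.

Lemma beta_formD (A : comNzRingType) m (p q : {poly A}) :
  beta_form m (p + q) = beta_form m p + beta_form m q.
Proof.
by rewrite -big_split /=; apply: eq_bigr => k _; rewrite coefD mulrDl.
Qed.

Lemma beta_formZ (A : comNzRingType) m (a : A) (p : {poly A}) :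
  beta_form m (a *: p) = a * beta_form m p.
Proof.
by rewrite mulr_sumr; apply: eq_bigr => k _; rewrite coefZ mulrA.
Qed.

Lemma beta_form_sum (A : comNzRingType) m n (F : 'I_n -> {poly A}) :
  beta_form m (\sum_(i < n) F i) = \sum_(i < n) beta_form m (F i).
Proof.
rewrite /beta_form exchange_big /=; apply: eq_bigr => k _.
by rewrite coef_sum mulr_suml.
Qed.

Lemma beta_formXn (A : comNzRingType) m k : (k <= m)%N ->
  beta_form m ('X^k : {poly A}) = (k`! * (m - k)`!)%:R.
Proof.
move=> lekm; rewrite -ltnS in lekm.
rewrite /beta_form (bigD1 (Ordinal lekm)) //= coefXn eqxx mul1r.
rewrite big1 ?addr0 // => j; rewrite -val_eqE /= => /negPf nj.
by rewrite coefXn nj mul0r.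
Qed.

(** Homogenizing 1 + 'X gives u + (1 - u) = 1, so multiplication by 1 + 'X only
    changes the normalizing factorial. *)
Lemma beta_form_mulX (A : comNzRingType) m (p : {poly A}) :
  (size p <= m.+1)%N ->
  beta_form m.+1 (p * (1 + 'X)) = m.+2%:R * beta_form m p.
Proof.
move=> szp; rewrite mulrDr mulr1 beta_formD /beta_form.
rewrite big_ord_recr /= (nth_default _ szp) mul0r addr0.
rewrite [X in _ + X]big_ord_recl /= coefMX eqxx mul0r add0r.
rewrite -big_split mulr_sumr; apply: eq_bigr => k _ /=.
have lekm : (k <= m)%N by rewrite -ltnS.
rewrite coefMX /= /bump leq0n !add1n subSS /= (subSn lekm) !factS !natrM.
have -> : m.+2%:R = k.+1%:R + (m - k).+1%:R :> A.
  by rewrite -natrD; congr _%:R; rewrite addSn addnS subnKC.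
by ring.
Qed.

(** The Beta integral form of a weighted count of subsets: b elements have
    weight 2, r elements have weight 1, and a subset of cardinality s and total
    weight k contributes s! (b + r - s)! to the coefficient of 'X^k
    ([pair_polyE]). *)
Definition pair_poly (R : comNzRingType) (b r : nat) : {poly R} :=
  beta_form (b + r) ((1 + 'X^2 *: 'X) ^+ b * (1 + 'X *: 'X) ^+ r).

Lemma pair_polyE (R : comNzRingType) b r :
  pair_poly R b r = \sum_(x < b.+1) \sum_(z < r.+1)
    ('C(b, x) * 'C(r, z) * ((x + z)`! * (b + r - (x + z))`!))%:R
      * 'X^(x + x + z).
Proof.
rewrite /pair_poly !exprDn mulr_suml beta_form_sum; apply: eq_bigr => x _.
rewrite mulr_sumr beta_form_sum; apply: eq_bigr => z _.
rewrite !expr1n !mul1r !exprZn.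
have -> : 'X^2 ^+ x *: 'X^x *+ 'C(b, x) * ('X ^+ z *: 'X^z *+ 'C(r, z)) =
    ('C(b, x)%:R * 'C(r, z)%:R * 'X^(x + x + z)) *: 'X^(x + z) :> {poly {poly R}}.
  rewrite -!mul_polyC !rmorphM !rmorph_nat /= -!exprM mul2n -addnn !exprD.
  by rewrite !rmorphM /=; ring.
rewrite beta_formZ beta_formXn; last by rewrite leq_add // -ltnS.
by rewrite !natrM; ring.
Qed.

(** The recursion is the image under [beta_form] of the identity
    1 + x^2 z = (1 + x) (1 + x z) - x (1 + z). *)
Lemma pair_poly_rec (R : comNzRingType) b r :
  pair_poly R b.+1 r = (1 + 'X) * pair_poly R b r.+1
    - 'X * ((b + r).+2%:R * pair_poly R b r).
Proof.
rewrite /pair_poly -beta_form_mulX; last first.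
  have sz (a : {poly R}) : (size (1 + a *: 'X : {poly {poly R}})%R <= 2)%N.
    rewrite (leq_trans (size_polyD _ _)) // size_poly1 geq_max /=.
    by rewrite (leq_trans (size_scale_leq _ _)) // size_polyX.
  have szn (a : {poly R}) n :
      (size ((1 + a *: 'X : {poly {poly R}}) ^+ n)%R <= n.+1)%N.
    rewrite (leq_trans (size_poly_exp_leq _ _)) // ltnS.
    by rewrite -{2}[n]mul1n leq_mul2r; apply/orP; right; rewrite -subn1 leq_subLR.
  rewrite (leq_trans (size_polyMleq _ _)) //.
  rewrite -subn1 leq_subLR add1n -addnS -addSn.
  by rewrite (leq_trans (leq_add (szn _ _) (szn _ _))) // addnS addSn.
rewrite addnS -addSn -mulNr -!beta_formZ -beta_formD; congr beta_form.
by rewrite -!mul_polyC !exprS expr0 mulr1 !(rmorphM, rmorphD, rmorphN, rmorph1) /=; ring.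
Qed.

Lemma pair_poly0 (R : comNzRingType) r :
  pair_poly R 0 r = r`!%:R * \sum_(z < r.+1) 'X^z.
Proof.
rewrite pair_polyE big_ord1 mulr_sumr; apply: eq_bigr => z _.
rewrite bin0 mul1n !add0n; congr (_%:R * _).
by rewrite bin_fact // -ltnS.
Qed.

Lemma coef_pair_poly (R : comNzRingType) b r i : (i <= b + r)%N ->
  ((1 - 'X) * pair_poly R b r)`_i =
  (-1) ^+ i * (b`! * r`! * 'C(b + r - i, r))%:R.
Proof.
elim: b r i => [|b IH] r i le_i.
  rewrite pair_poly0 mulrCA.
  have -> : (1 - 'X) * \sum_(z < r.+1) 'X^z = 1 - 'X^(r.+1) :> {poly R}.
    by rewrite -[1 - 'X]opprB mulNr -subrX1 opprB.
  rewrite -[_%:R]polyC_natr coefCM coefB coef1 coefXn.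
  rewrite (ltn_eqF (_ : i < r.+1)%N) // subr0.
  case: i le_i => [|i] le_i; first by rewrite subn0 binn muln1 mul1n mul1r mulr1.
  rewrite /= bin_small ?muln0 ?mulr0 //.
  by rewrite add0n in le_i *; rewrite ltn_subrL /= (leq_trans _ le_i).
rewrite pair_poly_rec.
have -> : (1 - 'X) * ((1 + 'X) * pair_poly R b r.+1 - 'X * ((b + r).+2%:R * pair_poly R b r))
   = (1 - 'X) * pair_poly R b r.+1 + (((1 - 'X) * pair_poly R b r.+1)
     - (b + r).+2%:R * ((1 - 'X) * pair_poly R b r)) * 'X by ring.
rewrite coefD coefMX coefB -polyC_natr coefCM IH; last by rewrite addnS -addSn.
case: i le_i => [|i] le_i /=.
  rewrite addr0 !subn0; congr (_ * _%:R).
  have := bin_fact (leq_addl b r.+1); have := bin_fact (leq_addl b.+1 r).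
  rewrite !addnK addnS -addSn => <- H.
  by rewrite -(mulnC 'C(_, r)) -(mulnC 'C(_, r.+1)) [(b`! * _)%N]mulnC H [((b.+1)`! * _)%N]mulnC.
rewrite addSn ltnS in le_i.
rewrite !IH //; last by rewrite addnS ltnW.
rewrite addnS addSn !subSS (subSn le_i) binS !factS !(natrM, natrD) exprS.
by rewrite -[(b + r).+2]addn2 -[b.+1]addn1 -[r.+1]addn1 !natrD; ring.
Qed.

(** * Invariant subsets of a permutation *)

(** Its k-th coefficient is the permutation character of the action on
    k-subsets. *)
Definition invariant_poly (R : comNzRingType) (T : finType) (w : {perm T}) :
  {poly R} := \sum_(S : {set T} | w @: S == S) 'X^#|S|.

Lemma invariant_polyJ (R : comNzRingType) (T : finType) (w h : {perm T}) :
  invariant_poly R (w ^ h)%g = invariant_poly R w.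
Proof.
rewrite /invariant_poly (reindex_inj (@imset_perm_inj _ h)) /=.
apply: eq_big => [S|S _]; last by rewrite card_imset_perm.
rewrite conjgE !imset_permM imset_permK.
by rewrite (inj_eq (@imset_perm_inj _ h)).
Qed.

Lemma trivIset_porbits (T : finType) (w : {perm T}) : trivIset (porbits w).
Proof.
apply/trivIsetP=> _ _ /imsetP[x _ ->] /imsetP[y _ ->]; apply: contraNT.
rewrite -setI_eq0 => /set0Pn[z]; rewrite inE -!eq_porbit_mem.
by case/andP=> /eqP <- /eqP <-.
Qed.

(** Expanding the product amounts to choosing a set of cycles, and the unions
    of cycles are the invariant subsets. *)
Lemma invariant_poly_porbits (R : comNzRingType) (T : finType) (w : {perm T}) :
  \prod_(C in porbits w) (1 + 'X^#|C|) = invariant_poly R w.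
Proof.
rewrite big_mkcond /=.
transitivity (\prod_(C : {set T})
    ((if C \in porbits w then 'X^#|C| else 0) + 1 : {poly R})).
  by apply: eq_bigr => C _; case: ifP; rewrite ?add0r // addrC.
rewrite bigA_distr /=.
transitivity (\sum_(A : {set {set T}} | A \subset porbits w)
   'X^#|cover A| : {poly R}).
  rewrite [RHS]big_mkcond /=; apply: eq_bigr => A _.
  rewrite -big_mkcond /=; case: ifPn => [sA|].
    rewrite -(eqP (trivIsetS sA (trivIset_porbits w))).
    rewrite expr_sum; apply: eq_bigr => C CA; by rewrite (subsetP sA).
  by case/subsetPn=> C CA nC; rewrite (bigD1 C) //= (negPf nC) mul0r.
rewrite /invariant_poly.
have porbit_sub (S : {set T}) x : w @: S = S -> x \in S -> porbit w x \subset S.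
  move=> wS xS; apply/subsetP=> y /porbitP[i ->]; elim: i => [|i IHi].
    by rewrite expg0 perm1.
  by rewrite expgSr permM -wS mem_imset_perm.
rewrite [RHS](reindex_onto (@cover T) (fun S => porbit w @: S)) /=; last first.
  move=> S /eqP wS; apply/eqP; rewrite eqEsubset; apply/andP; split.
    by apply/bigcupsP=> C /imsetP[x xS ->]; apply: porbit_sub.
  apply/subsetP=> x xS; apply/bigcupP; exists (porbit w x); last exact: porbit_id.
  exact: imset_f.
apply: eq_bigl => A; apply/idP/andP=> [sA|[_ /eqP <-]]; last first.
  by apply/subsetP=> C /imsetP[x _ ->]; apply: imset_f.
split.
  rewrite eqEcard card_imset_perm leqnn andbT.
  apply/subsetP=> _ /imsetP[x /bigcupP[C CA xC] ->]; apply/bigcupP; exists C => //.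
  have /imsetP[z _ Cz] := subsetP sA C CA; move: xC; rewrite Cz -!eq_porbit_mem.
  by move=> /eqP <-; rewrite -(porbit_perm w 1 x) expg1.
apply/eqP/setP=> C; apply/imsetP/idP=> [[x /bigcupP[C' CA xC] ->]|CA].
  have /imsetP[z _ Cz] := subsetP sA C' CA; move: xC; rewrite Cz -eq_porbit_mem.
  by move=> /eqP ->; rewrite -Cz.
have /imsetP[z _ Cz] := subsetP sA C CA; exists z => //.
by apply/bigcupP; exists C => //; rewrite Cz porbit_id.
Qed.

Lemma sum_invariant_poly (R : comNzRingType) (T : finType) (I J : {set T}) :
  \sum_(w : {perm T} | w @: I == J) invariant_poly R w =
  \sum_(S : {set T})
    #|[set w : {perm T} | (w @: I == J) && (w @: S == S)]|%:R * 'X^#|S|.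
Proof.
rewrite (exchange_big_dep predT) //=; apply: eq_bigr => S _.
rewrite sumr_const mulr_natl; congr (_ *+ _).
by apply: eq_card => w; rewrite inE.
Qed.

Lemma sum_invariant_poly_stab (R : comNzRingType) (T : finType) (I : {set T}) :
  \sum_(w : {perm T} | w @: I == I) invariant_poly R w =
  (#|I|`! * #|~: I|`!)%:R *
    ((\sum_(x < #|I|.+1) 'X^x) * \sum_(y < #|~: I|.+1) 'X^y).
Proof.
rewrite sum_invariant_poly.
pose c k n := (n`! * (k - n)`!)%N.
transitivity (\sum_(S : {set T} | S \subset setT)
   ((c #|I| #|S :&: I|)%:R * 'X^#|S :&: I|) *
   ((c #|~: I| #|S :\: I|)%:R * 'X^#|S :\: I|) : {poly R}).
  apply: eq_big => [S|S _]; first by rewrite subsetT.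
  rewrite card_transporter_stable // -(cardsID I S) exprD !natrM; ring.
rewrite (sum_subset_split (fun S1 S2 => ((c #|I| #|S1|)%:R * 'X^#|S1|) *
   ((c #|~: I| #|S2|)%:R * 'X^#|S2|) : {poly R}) (subsetT I)) setTD.
rewrite -big_distrlr /=.
have E (D : {set T}) : \sum_(S : {set T} | S \subset D) (c #|D| #|S|)%:R * 'X^#|S|
    = #|D|`!%:R * \sum_(x < #|D|.+1) 'X^x :> {poly R}.
  rewrite (sum_subset_card D (fun x => (c #|D| x)%:R * 'X^x)) mulr_sumr.
  apply: eq_bigr => x _; rewrite -[LHS]mulr_natl mulrA -natrM bin_fact //.
  by rewrite -ltnS.
by rewrite !E natrM; ring.
Qed.

(** A subset S contributes when it meets D and E in the same number x of
    elements.  With z its number of elements outside D and E, it then behaves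
    like a choice of x elements of weight 2 and z elements of weight 1. *)
Lemma sum_invariant_poly_disjoint (R : comNzRingType) (T : finType)
    (D E : {set T}) : [disjoint D & E] -> #|D| = #|E| ->
  \sum_(w : {perm T} | w @: D == E) invariant_poly R w =
  #|D|`!%:R * pair_poly R #|D| (#|T| - #|D|.*2).
Proof.
move=> dDE cDE; rewrite sum_invariant_poly; set b := #|D|; set r := (_ - _)%N.
have sED : E \subset ~: D by rewrite -disjoints_subset disjoint_sym.
have cr : #|~: D :\: E| = r.
  by rewrite cardsD (setIidPr sED) -cDE cardsCs setCK /r /b -addnn subnDA.
have cC : #|~: D| = (b + r)%N.
  by rewrite -(cardsID E) (setIidPr sED) cr -cDE.
pose g x x' z : {poly R} := if x == x' then
  (x`! * (b - x)`! * ((x + z)`! * (b + r - (x + z))`!))%:R * 'X^(x + x + z) else 0.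
transitivity (\sum_(S : {set T} | S \subset setT)
    g #|S :&: D| #|(S :\: D) :&: E| #|(S :\: D) :\: E|).
  apply: eq_big => [S|S _]; first by rewrite subsetT.
  have SE : (S :\: D) :&: E = S :&: E.
    apply/setP=> x; rewrite !inE; have [xE|] := boolP (x \in E); last by rewrite !andbF.
    by rewrite (disjointFl dDE xE).
  rewrite /g SE; case: eqP => [c|nc].
    rewrite card_transporter_stable // cC -(cardsID D S).
    have -> : #|S :\: D| = (#|S :&: D| + #|S :\: D :\: E|)%N.
      by rewrite -(cardsID E (S :\: D)) SE -c.
    by rewrite addnA.
  have -> : [set w : {perm T} | (w @: D == E) && (w @: S == S)] = set0.
    apply/setP=> w; rewrite !inE; apply/negP => /andP[/eqP wD /eqP wS]; apply: nc.
    by rewrite -(card_imset_perm w) imset_permI wD wS.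
  by rewrite cards0 mul0r.
rewrite (sum_subset_split (fun S1 S2 => g #|S1| #|S2 :&: E| #|S2 :\: E|) (subsetT D)).
rewrite setTD.
rewrite (eq_bigr (fun S1 : {set T} => \sum_(x' < #|E|.+1)
    (\sum_(z < r.+1) g #|S1| x' z *+ 'C(r, z)) *+ 'C(#|E|, x'))); last first.
  move=> S1 _; rewrite (sum_subset_split (fun S2 S3 => g #|S1| #|S2| #|S3|) sED).
  rewrite (eq_bigr (fun S2 : {set T} => \sum_(z < r.+1) g #|S1| #|S2| z *+ 'C(r, z))).
    by rewrite (sum_subset_card E
      (fun x' => \sum_(z < r.+1) g #|S1| x' z *+ 'C(r, z))).
  by move=> S2 _; rewrite (sum_subset_card _ (fun z => g #|S1| #|S2| z)) cr.
rewrite (sum_subset_card D (fun x => \sum_(x' < #|E|.+1)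
    (\sum_(z < r.+1) g x x' z *+ 'C(r, z)) *+ 'C(#|E|, x'))).
rewrite pair_polyE mulr_sumr -cDE; apply: eq_bigr => x _.
rewrite (bigD1 x) //= [X in _ + X]big1 ?addr0; last first.
  move=> x' nx; rewrite big1 ?mul0rn // => z _; rewrite /g.
  by rewrite eq_sym -val_eqE /= in nx; rewrite (negPf nx) mul0rn.
rewrite -!sumrMnl mulr_sumr; apply: eq_bigr => z _; rewrite /g eqxx.
have lexb : (x <= b)%N by rewrite -ltnS.
rewrite -!mulrnAl -!mulrnA mulrA -natrM; congr (1 *+ _ * _).
by rewrite -/b -[in RHS](bin_fact lexb); ring.
Qed.

(** The inner products of the permutation characters on subsets; only the
    stabilizers of k-subsets contribute to the k-th coefficient. *)
Lemma sum_invariant_poly_coef (R : comNzRingType) (T : finType) k :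
  (k <= #|T|)%N ->
  \sum_(w : {perm T}) (invariant_poly R w)`_k *: invariant_poly R w =
  #|T|`!%:R * ((\sum_(x < k.+1) 'X^x) * \sum_(y < (#|T| - k).+1) 'X^y).
Proof.
move=> lek.
transitivity (\sum_(w : {perm T}) \sum_(S : {set T} | (w @: S == S) && (#|S| == k))
    invariant_poly R w).
  apply: eq_bigr => w _; rewrite coef_sum big_mkcondr scaler_suml.
  by apply: eq_bigr => S _; rewrite coefXn eq_sym; case: eqP; rewrite ?scale1r ?scale0r.
rewrite (exchange_big_dep (fun S : {set T} => #|S| == k)) /=; last first.
  by move=> w S _ /andP[].
rewrite (eq_bigr (fun _ => (k`! * (#|T| - k)`!)%:R *
    ((\sum_(x < k.+1) 'X^x) * \sum_(y < (#|T| - k).+1) 'X^y))); last first.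
  move=> S /eqP cS; rewrite -cS -(cardsC S) addKn -sum_invariant_poly_stab.
  by apply: eq_bigl => w; rewrite eqxx andbT.
rewrite sumr_const -mulrnAl -mulrnA; congr (1 *+ _ * _).
rewrite -(bin_fact lek) -card_draws mulnC; congr (_ * _)%N.
by apply: eq_card => S; rewrite inE.
Qed.

(** * The character of a two-row partition *)

(** The difference of the permutation characters on i-subsets and on
    (i-1)-subsets; the formulation with 1 - 'X covers i = 0. *)
Definition two_row_char (R : comNzRingType) (T : finType) (i : nat)
    (w : {perm T}) : R := ((1 - 'X) * invariant_poly R w)`_i.

Lemma two_row_charE (R : comNzRingType) (T : finType) i (w : {perm T}) :
  two_row_char R i w = (invariant_poly R w)`_i -
    (if i == 0%N then 0 else (invariant_poly R w)`_i.-1).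
Proof. by rewrite /two_row_char mulrBl mul1r coefB coefXM. Qed.

Lemma two_row_charJ (R : comNzRingType) (T : finType) i (w h : {perm T}) :
  two_row_char R i (w ^ h)%g = two_row_char R i w.
Proof. by rewrite /two_row_char invariant_polyJ. Qed.

Lemma sum_mul_two_row_char (R : comNzRingType) (T : finType) i (c : R)
    (u : {perm T} -> R) :
  (forall k, (k <= i)%N ->
     \sum_(w : {perm T}) u w * (invariant_poly R w)`_k = c * (k == i)%:R) ->
  \sum_(w : {perm T}) u w * two_row_char R i w = c.
Proof.
move=> uP; under eq_bigr do rewrite two_row_charE mulrBr.
rewrite sumrB uP // eqxx mulr1; case: i uP => [|i] uP /=.
  by rewrite big1 ?subr0 // => w _; rewrite mulr0.
by rewrite uP // (ltn_eqF (ltnSn i)) mulr0 subr0.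
Qed.

Lemma coef_sum_Xn (R : comNzRingType) m j :
  (\sum_(y < m) 'X^y : {poly R})`_j = (j < m)%:R.
Proof.
have -> : \sum_(y < m) 'X^y = \poly_(y < m) 1 :> {poly R}.
  by rewrite poly_def; apply: eq_bigr => y _; rewrite scale1r.
by rewrite coef_poly; case: ltnP.
Qed.

(** By [sum_invariant_poly_coef] the sum is #|T|! times the i-th coefficient of
    (1 - 'X^k.+1) (1 + 'X + ... + 'X^(#|T| - k)). *)
Lemma sum_two_row_char_mul (R : comNzRingType) (T : finType) i k :
  (i.*2 <= #|T|)%N -> (k <= i)%N ->
  \sum_(w : {perm T}) two_row_char R i w * (invariant_poly R w)`_k =
  #|T|`!%:R * (k == i)%:R.
Proof.
move=> lei leki; have lek : (k <= #|T|)%N by lia.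
transitivity (((1 - 'X) * \sum_(w : {perm T})
    (invariant_poly R w)`_k *: invariant_poly R w)`_i).
  rewrite mulr_sumr coef_sum; apply: eq_bigr => w _.
  by rewrite -scalerAr coefZ mulrC.
rewrite sum_invariant_poly_coef // mulrCA -[_%:R in LHS]polyC_natr coefCM.
rewrite mulrA; have -> : (1 - 'X) * (\sum_(x < k.+1) 'X^x) = 1 - 'X^(k.+1) :> {poly R}.
  by rewrite -[1 - 'X]opprB mulNr -subrX1 opprB.
rewrite mulrBl mul1r coefB coefXnM !coef_sum_Xn; congr (_ * _).
have [ltik|ltki|eqik] := ltngtP k i; last first.
- by rewrite eqik ltnSn subr0; have -> : (i < (#|T| - i).+1)%N by lia.
- by lia.
have -> : (i < k.+1)%N = false by lia.
have -> : (i < (#|T| - k).+1)%N by lia.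
have -> : (i - k.+1 < (#|T| - k).+1)%N by lia.
by rewrite subrr.
Qed.

Lemma two_row_char_real (T : finType) i (w : {perm T}) :
  two_row_char algC i w \is Num.real.
Proof.
have PR k : (invariant_poly algC w)`_k \is Num.real.
  rewrite coef_sum; apply: rpred_sum => S _.
  by rewrite coefXn realn.
by rewrite two_row_charE rpredB ?PR //; case: ifP; rewrite ?rpred0 ?PR.
Qed.

(** Both chi and the two-row character satisfy the hypothesis of
    [sum_mul_two_row_char], so each has inner product 1 with the latter; as chi
    has norm 1, the difference has norm 0. *)
Lemma irr_two_row (n i : nat) (chi : 'CF([set: 'S_n])) :
  chi \in irr [set: 'S_n] -> (i.*2 <= n)%N ->
  (forall k, (k <= i)%N ->
     \sum_(w : 'S_n) chi w * (invariant_poly algC w)`_k =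
     n`!%:R * (k == i)%:R) ->
  forall w, chi w = two_row_char algC i w.
Proof.
case/irrP=> j chiE lei chiP.
have cS : #|[set: 'S_n]| = n`! by rewrite cardsT card_Sn.
have nz : (n`!%:R : algC) != 0 by rewrite pnatr_eq0 -lt0n fact_gt0.
have chi2 : \sum_(w : 'S_n) chi w * (chi w)^* = n`!%:R.
  have := cfnorm_irr j; rewrite -chiE cfdotE cS => /(congr1 (fun c => n`!%:R * c)).
  rewrite mulrA mulfV // mul1r mulr1 => <-.
  by apply: eq_bigl => w; rewrite inE.
have lei' : (i.*2 <= #|'I_n|)%N by rewrite card_ord.
have th2 : \sum_(w : 'S_n) two_row_char algC i w * two_row_char algC i w = n`!%:R.
  apply: sum_mul_two_row_char => k lek.
  by rewrite sum_two_row_char_mul ?card_ord.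
have chith : \sum_(w : 'S_n) chi w * two_row_char algC i w = n`!%:R.
  exact: sum_mul_two_row_char.
have thchi : \sum_(w : 'S_n) two_row_char algC i w * (chi w)^* = n`!%:R.
  rewrite -(rmorph_nat (Num.conj : algC -> algC)) -chith rmorph_sum /=.
  apply: eq_bigr => w _; rewrite rmorphM /= mulrC; congr (_ * _).
  by rewrite conj_Creal ?two_row_char_real.
have S0 : \sum_(w : 'S_n) `|chi w - two_row_char algC i w| ^+ 2 = 0.
  transitivity (\sum_(w : 'S_n) (chi w * (chi w)^* - two_row_char algC i w * (chi w)^*
     - (chi w * two_row_char algC i w - two_row_char algC i w * two_row_char algC i w))).
    apply: eq_bigr => w _; rewrite normCK rmorphB /=.
    by rewrite [(two_row_char _ _ _)^*]conj_Creal ?two_row_char_real //; ring.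
  by rewrite !sumrB chi2 th2 chith thchi !subrr.
move=> w; apply/eqP; rewrite -subr_eq0 -normr_eq0 -sqrf_eq0.
apply/eqP; move: S0 => /eqP; rewrite psumr_eq0; last first.
  by move=> v _; rewrite exprn_ge0 ?normr_ge0.
by move=> /allP/(_ w); rewrite mem_index_enum => /(_ isT)/eqP.
Qed.

(** * Schur polynomials in two variables *)

(** The Schur polynomial evaluated at the two variables 1 and 'X. *)
Definition schur_poly2 (lam : seq nat) : {poly algC} :=
  \sum_(T : {ffun box lam -> 'I_2} | semistandard T)
     'X^#|[set a | T a != ord0]|.

Lemma frobenius_ch2 (n : nat) (lam : seq nat) (chi : 'CF([set: 'S_n])) :
  frobenius_ch 2 chi = schur 2 lam ->
  \sum_(w : 'S_n) chi w *: invariant_poly algC w = n`!%:R * schur_poly2 lam.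
Proof.
pose h (j : 'I_2) : {poly algC} := if j == ord0 then 1 else 'X.
pose phi : {mpoly algC[2]} -> {poly algC} := mmap (@polyC algC) h.
have phiX j : phi 'X_j = h j by rewrite /phi mmapX mmap1U.
have phiZ c p : phi (c *: p) = c%:P * phi p by exact: mmapZ.
have phip k : phi (power_sum 2 k) = 1 + 'X^k.
  rewrite /power_sum big_ord_recl big_ord1 /phi rmorphD !rmorphXn /=.
  by rewrite -/phi !phiX /h /= expr1n.
have nz : (n`!%:R : algC) != 0 by rewrite pnatr_eq0 -lt0n fact_gt0.
move=> /(congr1 phi) H.
have -> : schur_poly2 lam = phi (schur 2 lam).
  rewrite /schur /phi rmorph_sum; apply: eq_bigr => T _.
  rewrite rmorph_prod /= -/phi -sum1_card.
  rewrite (eq_bigr (fun a => if T a != ord0 then 'X else 1)).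
    rewrite -big_mkcond prodr_const -sum1_card.
    by congr (_ ^+ _); apply: eq_bigl => a; rewrite inE.
  by move=> a _; rewrite phiX /h; case: eqP.
rewrite -H /frobenius_ch phiZ /= -[n`!%:R]polyC_natr mulrA -polyCM mulfV //.
rewrite mul1r /phi rmorph_sum -/phi; apply: eq_bigr => w _.
rewrite [RHS]phiZ mul_polyC -invariant_poly_porbits; congr (_ *: _).
rewrite /phi rmorph_prod /=.
by apply: eq_bigr => C _; rewrite -/phi phip.
Qed.

(** Three boxes in the first column would need three distinct values out of
    two. *)
Lemma schur_poly2_long (lam : seq nat) :
  0%N \notin lam -> (2 < size lam)%N -> schur_poly2 lam = 0.
Proof.
move=> lam0 sz; rewrite /schur_poly2 big_pred0 // => T; apply/negP=> /forallP ssT.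
have pos (r : 'I_(size lam)) : (0 < nth 0%N lam r)%N.
  by rewrite lt0n; apply: contraNneq lam0 => <-; apply: mem_nth.
pose bx (k : nat) (lt : (k < size lam)%N) : box lam :=
  Tagged (fun r : 'I_(size lam) => 'I_(nth 0%N lam r)) (Ordinal (pos (Ordinal lt))).
have lt0 : (0 < size lam)%N by lia.
have lt1 : (1 < size lam)%N by lia.
have /forallP/(_ (bx 1 lt1))/andP[_ /implyP/(_ isT) T01] := ssT (bx 0 lt0).
have /forallP/(_ (bx 2 sz))/andP[_ /implyP/(_ isT) T12] := ssT (bx 1 lt1).
have := leq_ltn_trans (leq_ltn_trans (leq0n _) T01) T12.
by rewrite ltnNge -ltnS ltn_ord.
Qed.

Lemma card_lower_boxes (n i : nat) :
  #|[set a : box (two_row n i) | box_row a != 0%N]| = i.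
Proof.
rewrite -sum1_card.
transitivity (\sum_(r < size (two_row n i) | r != 0%N :> nat)
  \sum_(c < nth 0 (two_row n i) r) 1)%N.
  rewrite sig_big_dep /=; apply: eq_bigl => a.
  by rewrite inE andbT.
under eq_bigr do rewrite sum1_card card_ord.
rewrite /two_row; have [->|nzi] := eqVneq i 0%N.
  by rewrite big1 // => -[[|r] ltr] //; case: n ltr => //=.
by rewrite /= big_mkcond big_ord_recl big_ord1 /=.
Qed.

(** Every box of the second row lies below a box of the first, so it contains
    the larger value: a tableau has at least i large entries, and exactly i only
    when each box contains its row index. *)
Lemma coef_schur_poly2 (n i k : nat) :
  is_partition n (two_row n i) -> (k <= i)%N ->
  (schur_poly2 (two_row n i))`_k = (k == i)%:R.
Proof.
set lam := two_row n i => lamP leki.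
have sz2 : (size lam <= 2)%N.
  by rewrite /lam /two_row; case: eqP => // _; rewrite size_nseq; case: (0 < n)%N.
have row2 (a : box lam) : (box_row a < 2)%N by apply: leq_trans (ltn_ord (tag a)) sz2.
pose T0 : {ffun box lam -> 'I_2} := [ffun a => inord (box_row a)].
have T0E a : T0 a = box_row a :> nat by rewrite ffunE inordK.
have above (a : box lam) :
    exists b : box lam, box_row b = 0%N /\ box_col b = box_col a.
  case: a => r c; rewrite /box_row /box_col /=.
  have lt0 : (0 < size lam)%N by apply: leq_trans (ltn_ord r).
  have ltc : (c < nth 0%N lam (Ordinal lt0))%N.
    apply: leq_trans (ltn_ord c) _ => /=.
    have [sl _ _] := and3P lamP.
    have geq_trans : transitive geq by move=> y x z leyx lezy; apply: leq_trans lezy leyx.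
    exact: (sorted_leq_nth geq_trans leqnn 0%N sl _ _ lt0 (ltn_ord r) (leq0n r)).
  by exists (Tagged (fun r : 'I_(size lam) => 'I_(nth 0%N lam r)) (Ordinal ltc)).
have ssT0 : semistandard T0.
  apply/forallP=> a; apply/forallP=> b; rewrite !T0E; apply/andP; split.
    by apply/implyP=> /andP[/eqP -> _].
  by apply/implyP=> /andP[].
have sub (T : {ffun box lam -> 'I_2}) : semistandard T ->
    [set a | box_row a != 0%N] \subset [set a | T a != ord0].
  move=> /forallP ssT; apply/subsetP=> a; rewrite !inE => nza.
  have [b [b0 bc]] := above a.
  have /forallP/(_ a)/andP[_ /implyP] := ssT b.
  rewrite bc eqxx b0 lt0n nza => /(_ isT) ltT.
  by rewrite -val_eqE /= -lt0n; apply: leq_ltn_trans ltT.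
have cT0 : #|[set a | T0 a != ord0]| = i.
  rewrite -[RHS](card_lower_boxes n i); apply: eq_card => a.
  by rewrite !inE -val_eqE /= T0E.
rewrite coef_sum (bigD1 T0) //= coefXn cT0 big1 ?addr0 // => T /andP[ssT nT].
rewrite coefXn; case: eqP => // kE; case/eqP: nT; apply/ffunP=> a; apply/val_inj.
rewrite /= T0E.
have eqS : [set a | box_row a != 0%N] = [set a | T a != ord0].
  by apply/eqP; rewrite eqEcard sub //= card_lower_boxes -kE.
have /setP/(_ a) := eqS; rewrite !inE -val_eqE /=.
by have := row2 a; have := ltn_ord (T a); lia.
Qed.

(** * Transporters in an irreducible representation *)

(** If E = C *m R is a full-rank factorization, then R *m C is the scalar c, so
    the trace of E is c times its rank. *)
Lemma trace0_quasi_idempotent (F : numFieldType) n (c : F) (E : 'M[F]_n) :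
  c != 0 -> E *m E = c *: E -> \tr E = 0 -> E = 0.
Proof.
move=> nzc EE trE.
have [C' C'C] := row_fullP (col_base_full E).
have [R' RR'] := row_freeP (row_base_free E).
have C'E : C' *m E = row_base E
  by have := congr1 (mulmx C') (mulmx_base E); rewrite mulmxA C'C mul1mx => ->.
have ER' : E *m R' = col_base E
  by have := congr1 (mulmx^~ R') (mulmx_base E); rewrite /= -mulmxA RR' mulmx1 => ->.
have RC : row_base E *m col_base E = c%:M.
  rewrite -C'E -ER' mulmxA -(mulmxA C') EE -scalemxAr -scalemxAl C'E RR'.
  by rewrite scalemx1.
apply/eqP; rewrite -mxrank_eq0; move: trE.
rewrite -(congr1 mxtrace (mulmx_base E)) mxtrace_mulC RC mxtrace_scalar => /eqP.
by rewrite mulrn_eq0 (negPf nzc) orbF.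
Qed.

(** The hypothesis is the sum of f over the stabilizers of all the sets of size
    #|I|, which are conjugate. *)
Lemma sum_stabilizer_eq0 (F : numFieldType) (T : finType) (f : {perm T} -> F)
    (f_class : forall w h : {perm T}, f (w ^ h)%g = f w) (I : {set T}) :
  \sum_(w : {perm T}) f w * (invariant_poly F w)`_#|I| = 0 ->
  \sum_(w : {perm T} | w @: I == I) f w = 0.
Proof.
move=> H; set s := \sum_(w | _) _.
suff: (\sum_(S : {set T} | #|S| == #|I|) s) = 0.
  rewrite sumr_const => /eqP; rewrite mulrn_eq0 => /orP[/pred0P/(_ I)|/eqP //].
  by rewrite /= (introT eqnP erefl).
rewrite -[RHS]H.
transitivity (\sum_(w : {perm T}) \sum_(S : {set T} | (w @: S == S) && (#|S| == #|I|)) f w).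
  rewrite [RHS](exchange_big_dep (fun S : {set T} => #|S| == #|I|)) /=; last first.
    by move=> w S _ /andP[].
  apply: eq_bigr => S /eqP/esym cS.
  have [h [hI _ _ _]] := exists_swap_stable cS.
  have := sum_conj f_class h I I I I; rewrite hI => hsum.
  transitivity (\sum_(w : {perm T} | (w @: I == I) && (w @: I == I)) f w).
    by apply: eq_bigl => w; rewrite andbb.
  rewrite hsum; apply: eq_bigl => w; rewrite andbb -cS eqxx andbT //.
apply: eq_bigr => w _; rewrite coef_sum mulr_sumr big_mkcondr /=.
apply: eq_bigr => S _; rewrite coefXn eq_sym.
by case: eqP; rewrite ?mulr1 ?mulr0.
Qed.

Lemma xcfun_bracket (n : nat) (chi : 'CF([set: 'S_n])) (I J : {set 'I_n}) :
  (chi.[bracket I J])%CF = \sum_(w : 'S_n | w @: I == J) chi w.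
Proof.
rewrite /bracket /gset_mx raddf_sum /=.
apply: eq_big => [w|w _]; first by rewrite inE.
by rewrite xcfunG ?inE.
Qed.

(** The sum E of the operators of the stabilizer of I satisfies
    E *m E = c *: E and has trace 0, hence vanishes; the transporter of I to J
    is a coset of that stabilizer. *)
Lemma sum_irr_transporter_eq0 (n : nat) (chi : 'CF([set: 'S_n]))
    (I J : {set 'I_n}) : chi \in irr [set: 'S_n] -> #|I| = #|J| ->
  \sum_(w : 'S_n | w @: I == I) chi w = 0 ->
  \sum_(w : 'S_n | w @: I == J) chi w = 0.
Proof.
case/irrP=> j -> eqIJ; rewrite -irrRepr; set rG := 'Chi_j => sum0.
have trE (P : pred 'S_n) : \sum_(w | P w) cfRepr rG w = \tr (\sum_(w | P w) rG w).
  by rewrite raddf_sum; apply: eq_bigr => w _; rewrite cfunE inE.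
pose H := [set w : 'S_n | w @: I == I].
pose E := \sum_(w : 'S_n | w @: I == I) rG w.
have EE : E *m E = #|H|%:R *: E.
  rewrite mulmx_suml scaler_nat -sumr_const.
  apply: eq_big => [w|w /eqP wI]; first by rewrite inE.
  rewrite mulmx_sumr /E [RHS](reindex_inj (mulgI w)) /=.
  apply: eq_big => [v|v _]; first by rewrite imset_permM wI.
  by rewrite repr_mxM ?inE.
have E0 : E = 0.
  apply: trace0_quasi_idempotent EE _; last by rewrite -trE.
  rewrite pnatr_eq0 -lt0n; apply/card_gt0P; exists 1%g.
  by rewrite inE; apply/eqP/imset_perm_fixed => x _; rewrite perm1.
have [h [hI _ _ _]] := exists_swap_stable eqIJ.
rewrite trE (reindex_inj (mulIg h)) /=.
transitivity (\tr (E *m rG h)); last by rewrite E0 mul0mx mxtrace0.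
congr mxtrace; rewrite /E mulmx_suml; apply: eq_big => [v|v _].
  by rewrite imset_permM -hI (inj_eq (@imset_perm_inj _ h)).
by rewrite repr_mxM ?inE.
Qed.

Lemma sum_two_row_char_disjoint (R : comNzRingType) (T : finType) i
    (D E : {set T}) : (i.*2 <= #|T|)%N -> [disjoint D & E] -> #|D| = #|E| ->
  \sum_(w : {perm T} | w @: D == E) two_row_char R i w =
  #|D|`!%:R * ((-1) ^+ i * (#|D|`! * (#|T| - #|D|.*2)`!
     * 'C(#|T| - #|D| - i, #|T| - #|D|.*2))%:R).
Proof.
move=> lei dDE cDE.
have leb : (#|D|.*2 <= #|T|)%N.
  have <- : #|D :|: E| = #|D|.*2.
    by rewrite cardsU (disjoint_setI0 dDE) cards0 subn0 -cDE addnn.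
  exact: max_card.
rewrite /two_row_char -coef_sum -mulr_sumr sum_invariant_poly_disjoint //.
rewrite mulrCA -polyC_natr coefCM coef_pair_poly; last by lia.
by have -> : (#|D| + (#|T| - #|D|.*2) - i = #|T| - #|D| - i)%N by lia.
Qed.

(** * Character values on transporters *)

Unset Implicit Arguments.

(* The leading factor #|I :\: J|`! is needed once #|I :\: J| > 1.  Without it,
   for n = 4, lam = (4), I = {1,2}, J = {3,4}, the right-hand side would be 2,
   whereas the trivial character takes the value 4 on {I, J}. *)
Theorem theorem4p5 (n : nat) (I J : {set 'I_n}) (hIJ : #|I| = #|J|)
    (lam : seq nat) (hlam : is_partition n lam)
    (chi : 'CF([set: 'S_n])) (hchi : is_irr_char_of lam chi) :
  ((2 < size lam)%N -> (chi.[bracket I J])%CF = 0)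
  /\
  (forall i : nat, lam = two_row n i ->
     (chi.[bracket I J])%CF =
       #|I :\: J|`!%:R *
       \sum_((i - #|I :\: J|)%N <= t < #|I :&: J|.+1)
         let b := (#|I :\: J| + t)%N in
         (-1) ^+ (t + i) *
         ('C(#|I :&: J|, t) * (n - #|I :|: J|) ^_ t * b`! * (n - b.*2)`!
            * 'C(n - b - i, n - b.*2))%:R).
Proof.
case: hchi => chi_irr chi_ch.
have chiP := frobenius_ch2 (chi_ch 2).
have chiJ (w h : 'S_n) : chi (w ^ h)%g = chi w by rewrite cfunJ ?inE.
have chi_coef k : \sum_(w : 'S_n) chi w * (invariant_poly algC w)`_k =
    n`!%:R * (schur_poly2 lam)`_k.
  transitivity ((\sum_(w : 'S_n) chi w *: invariant_poly algC w)`_k).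
    by rewrite coef_sum; apply: eq_bigr => w _; rewrite coefZ.
  by rewrite chiP -[n`!%:R in LHS]polyC_natr coefCM.
have [_ lam0 _] := and3P hlam.
rewrite xcfun_bracket; split=> [sz|i lamE].
  apply: sum_irr_transporter_eq0 => //; apply: sum_stabilizer_eq0 => //.
  by rewrite chi_coef schur_poly2_long // coef0 mulr0.
subst lam.
have lei : (i.*2 <= n)%N.
  move: hlam; rewrite /two_row; case: eqP => [->|_] //.
  by rewrite /is_partition /= => /and3P[]; lia.
have chiE : forall w, chi w = two_row_char algC i w.
  apply: irr_two_row => // k lek.
  by rewrite chi_coef coef_schur_poly2.
have lei' : (i.*2 <= #|'I_n|)%N by rewrite card_ord.
under eq_bigr do rewrite chiE.
rewrite (@sum_transporter_disjoint _ _ _ (two_row_charJ algC i)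
  (fun b => (-1) ^+ i * (b`! * (n - b.*2)`! * 'C(n - b - i, n - b.*2))%:R)) //.
  congr (_ * _); rewrite [RHS](big_nat_widenl _ 0) // big_mkcond big_mkord.
  apply: eq_bigr => t _; rewrite /=.
  have -> : #|~: (I :|: J)| = (n - #|I :|: J|)%N by rewrite cardsCs setCK card_ord.
  (* The terms below the lower summation bound have b < i and vanish. *)
  have below d k : (k < i - d)%N -> (n - (d + k) - i < n - (d + k).*2)%N by lia.
  case: leqP => [_|lt]; first by rewrite exprD !natrM; ring.
  rewrite (@bin_small (n - (#|I :\: J| + t) - i)); last exact: below.
  by rewrite muln0 mulr0n !mulr0.
by move=> D E dDE cDE; rewrite sum_two_row_char_disjoint // card_ord.
Qed.
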